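(* Let $p,r,k$ be positive integers. Then $$R_{p,r}(k) = \frac{r}{kp+r}\binom{kp+r}{k} = \sum_\lambda \binom{r}{\lambda_1} \binom{p \lambda_1}{\lambda_2} \binom{p \lambda_2}{\lambda_3} \cdots \binom{p \lambda_{j-1}}{\lambda_j},$$ where $\lambda = (\lambda_1,\lambda_2,\dots,\lambda_j)$ ranges over all ordered partitions (compositions) of $k$ into positive parts, of any length $j \geq 1$.
   Context: $R_{p,r}(n) = \frac{r}{np+r}\binom{np+r}{n}$ denotes the Raney number. *)

(* Defs.v *)
From HB Require Import structures.
From mathcomp Require Import all_boot all_order all_algebra.

Set Implicit Arguments.
Unset Strict Implicit.
Unset Printing Implicit Defensive.

Import GRing.Theory.

Definition raney (p r n : nat) : rat :=
  (r%:R / (n * p + r)%:R * 'C(n * p + r, n)%:R)%R.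

Definition is_composition (k : nat) (s : seq nat) : bool :=
  all (leq 1) s && (sumn s == k).

Record composition (k : nat) : Type := Composition {
  parts :> seq nat;
  parts_composition : is_composition k parts
}.

HB.instance Definition _ k := [isSub for @parts k].
HB.instance Definition _ k := [Countable of composition k by <:].

Section CompositionFinite.
Variable k : nat.

Lemma composition_sumn (s : composition k) : sumn s = k.
Proof. by case: s => s /= /andP[_ /eqP]. Qed.

Lemma composition_part_gt0 (s : composition k) x : x \in (s : seq nat) -> 0 < x.
Proof. by case: s => s /= /andP[/allP H _] /H. Qed.

Lemma composition_part_le (s : composition k) x : x \in (s : seq nat) -> x <= k.
Proof.
move=> xs; rewrite -(composition_sumn s) sumnE.
by rewrite (big_rem x) //= leq_addr.
Qed.

Lemma composition_size_le (s : composition k) : size s <= k.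
Proof.
rewrite -[leqRHS](composition_sumn s) -sum1_size sumnE big_seq [leqRHS]big_seq.
by apply: leq_sum => x; apply: composition_part_gt0.
Qed.

(* The empty composition occurs only for k = 0. *)
Lemma composition_size_gt0 (s : composition k) : 0 < k -> 0 < size s.
Proof. by rewrite -{1}(composition_sumn s); case: (parts s). Qed.

Lemma composition_bseq_subproof (s : composition k) :
  size [seq inord x : 'I_k.+1 | x <- s] <= k.
Proof. by rewrite size_map composition_size_le. Qed.

Definition composition_bseq (s : composition k) : k.-bseq 'I_k.+1 :=
  Bseq (composition_bseq_subproof s).

Definition bseq_composition (t : k.-bseq 'I_k.+1) : option (composition k) :=
  insub [seq val i | i <- t].

Lemma composition_bseqK : pcancel composition_bseq bseq_composition.
Proof.
move=> s; rewrite /bseq_composition /= -map_comp map_id_in ?valK // => x xs /=.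
by rewrite inordK // ltnS (composition_part_le xs).
Qed.

HB.instance Definition _ :=
  isFinite.Build (composition k) (pcan_enumP composition_bseqK).

End CompositionFinite.

(* Main.v *)
Require Import Defs.
From mathcomp Require Import all_boot all_order all_algebra.

(** Splitting off the first part a of a composition of n shows that the sum
    S(r, n) on the right-hand side satisfies
      S(r, n) = sum over 1 <= a <= n of C(r, a) S(pa, n - a).
    By induction S(pa, n - a) = (a / n) C(pn, n - a), and a C(r, a) =
    r C(r - 1, a - 1), so Vandermonde's convolution gives
    n S(r, n) = r C(pn + r - 1, n - 1), which is n R_{p,r}(n). *)

Set Implicit Arguments.
Unset Strict Implicit.
Unset Printing Implicit Defensive.

Import GRing.Theory Num.Theory.

Lemma is_composition_cons k (i : 'I_k) s :
  is_composition (k - i.+1) s -> is_composition k (i.+1 :: s).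
Proof.
by rewrite /is_composition /= => /andP[-> /eqP->] /=; rewrite subnKC.
Qed.

Definition composition_cons k (i : 'I_k) (s : composition (k - i.+1)) :
  composition k := Composition (is_composition_cons (parts_composition s)).

(** Makes [composition k] inhabited for every [k]: it serves as the default of [insubd] and, at
    [k = 0], as the empty composition. *)
Lemma is_composition_ones k : is_composition k (nseq k 1).
Proof. by rewrite /is_composition all_nseq orbT sumn_nseq mul1n eqxx. Qed.

Lemma is_composition_behead k s :
  is_composition k s -> is_composition (k - head 0 s) (behead s).
Proof.
rewrite /is_composition; case: s => [|a s] /=; first by rewrite subn0.
by case/andP=> /andP[_ ->] /eqP<-; rewrite addKn eqxx.
Qed.

Lemma big_composition_recl k (F : seq nat -> nat) : 0 < k ->
  \sum_(s : composition k) F s =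
  \sum_(i < k) \sum_(s : composition (k - i.+1)) F (i.+1 :: s).
Proof.
move=> k_gt0.
have head_gt0 (s : composition k) : 0 < head 0 s.
  by case: s (composition_size_gt0 s k_gt0) => [[|a s] //= /andP[/andP[]]].
have head_lt (s : composition k) : (head 0 s).-1 < k.
  rewrite prednK //; apply: (composition_part_le (s := s)).
  by case: (parts s) (composition_size_gt0 s k_gt0) => //= *; apply: mem_head.
rewrite (partition_big (fun s => Ordinal (head_lt s)) predT) //=.
apply: eq_bigr => i _.
rewrite (reindex (composition_cons (i := i))) /=.
  by apply: eq_bigl => s; rewrite -val_eqE /= eqxx.
(* Off the fibre of compositions with first part [i.+1], [behead s] has the wrong sum and [g] takes
   its default; only the fibre matters. *)
pose g (s : composition k) : composition (k - i.+1) :=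
  insubd (Composition (is_composition_ones _)) (behead s).
exists g => s; rewrite inE -val_eqE /=.
  by move=> _; apply: val_inj; rewrite val_insubd /= parts_composition.
move=> /eqP head_s; apply: val_inj; rewrite /= val_insubd /= -head_s prednK //.
rewrite is_composition_behead ?parts_composition //.
by case: (parts s) (composition_size_gt0 s k_gt0).
Qed.

(** The top [m] of the first binomial is a parameter, so that the tail after a part [a] has the same
    shape with [m] replaced by [p * a]. *)
Fixpoint chain_weight p m s :=
  if s is a :: s' then 'C(m, a) * chain_weight p (p * a) s' else 1.

Lemma chain_weightE p m s : 0 < size s ->
  chain_weight p m s =
  'C(m, nth 0 s 0) * \prod_(1 <= i < size s) 'C(p * nth 0 s i.-1, nth 0 s i).
Proof.
elim: s m => [|a s IHs] m //= _; congr (_ * _).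
case: s IHs => [_|b s IHs]; first by rewrite big_nil.
rewrite (IHs (p * a)) // [RHS]big_ltn //=; congr (_ * _).
by rewrite big_add1 [RHS]big_add1 [RHS]big_add1; apply: eq_bigr.
Qed.

Definition chain_sum p m n := \sum_(s : composition n) chain_weight p m s.

Lemma chain_sum0 p m : chain_sum p m 0 = 1.
Proof.
have nil0 (s : composition 0) : parts s = [::].
  by apply: size0nil; apply/eqP; rewrite -leqn0 composition_size_le.
rewrite /chain_sum (big_pred1 (Composition (is_composition_ones 0))) //= => s.
by apply/esym/eqP/val_inj; rewrite /= nil0.
Qed.

Lemma chain_sum_recl p m n : 0 < n ->
  chain_sum p m n = \sum_(i < n) 'C(m, i.+1) * chain_sum p (p * i.+1) (n - i.+1).
Proof.
move=> n_gt0; rewrite /chain_sum big_composition_recl //.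
by apply: eq_bigr => i _; rewrite big_distrr.
Qed.

(** Clearing the denominator keeps the strong induction inside [nat]; [m] stays general because the
    recursion changes it to [p * i.+1]. *)
Lemma mul_chain_sum p m n : 0 < n ->
  n * chain_sum p m n = m * 'C(p * n + m.-1, n.-1).
Proof.
elim/ltn_ind: n m => n IHn m n_gt0.
have step i : i < n ->
    n * chain_sum p (p * i.+1) (n - i.+1) = i.+1 * 'C(p * n, n - i.+1).
  (* When nothing remains, [i.+1 = n] and both sides are [n]; the induction hypothesis covers only a
     positive remainder. *)
  move=> lt_in; case def_d: (n - i.+1) => [|d].
    by rewrite chain_sum0 bin0; congr (_ * _); apply/eqP;
       rewrite eqn_leq lt_in andbT -subn_eq0 def_d.
  have def_n: n = d.+1 + i.+1 by rewrite -def_d subnK.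
  apply/eqP; rewrite -(eqn_pmul2l (ltn0Sn d)) mulnCA; apply/eqP.
  rewrite IHn //; last by rewrite def_n addnS ltnS leq_addr.
  rewrite [RHS]mulnCA -mul_bin_diag.
  case: p {IHn} => [|p]; first by rewrite !mul0n !muln0.
  rewrite (_ : _ + _ = (p.+1 * n).-1); last first.
    by rewrite [in RHS]def_n mulnDr [p.+1 * i.+1]mulSn addnS.
  by rewrite !mulnA; congr (_ * _); rewrite [LHS]mulnC mulnA mulnAC.
rewrite chain_sum_recl // big_distrr /=.
under eq_bigr => i _.
  rewrite mulnCA (step _ (ltn_ord i)) mulnA (mulnC _ i.+1) -mul_bin_diag -mulnA.
  over.
rewrite -big_distrr /= [p * n + _]addnC -binomial.Vandermonde; congr (_ * _).
by case: n n_gt0 {IHn step}.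
Qed.

Lemma mul_raney p r n : 0 < r -> 0 < n ->
  (n%:R * raney p r n = (r * 'C(p * n + r.-1, n.-1))%:R)%R.
Proof.
case: r n => // r [] // n _ _; rewrite /raney /=.
have nz : ((n.+1 * p + r.+1)%:R != 0 :> rat)%R by rewrite pnatr_eq0 addnS.
by rewrite mulrCA -natrM -mul_bin_diag natrM mulrA divfK // -natrM addnS (mulnC p).
Qed.

Theorem theorem2p6 (p r k : nat) (p_gt0 : 0 < p) (r_gt0 : 0 < r) (k_gt0 : 0 < k) :
  raney p r k =
    (\sum_(lam : composition k)
        'C(r, nth 0 lam 0) *
        \prod_(1 <= i < size lam) 'C(p * nth 0 lam i.-1, nth 0 lam i))%:R%R.
Proof.
have k_neq0 : (k%:R != 0 :> rat)%R by rewrite pnatr_eq0 -lt0n.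
apply: (mulfI k_neq0); rewrite mul_raney // -mul_chain_sum // natrM.
congr (_ * _%:R)%R; apply: eq_bigr => s _.
by rewrite chain_weightE // composition_size_gt0.
Qed.
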